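(* There exist non-trivial generalized Landsberg structures on a 3-manifold. That is, there exist a 3-dimensional manifold $\Sigma$, a coframing $\omega=(\omega^1,\omega^2,\omega^3)$ on $\Sigma$ and real-analytic functions $I,K:\Sigma\to\mathbb{R}$ such that $$d\omega^1=-I\,\omega^1\wedge\omega^3+\omega^2\wedge\omega^3,\qquad d\omega^2=-\omega^1\wedge\omega^3,\qquad d\omega^3=K\,\omega^1\wedge\omega^2,$$ and such that $(\Sigma,\omega)$ is not a generalized Berwald structure.
   Context: A generalized Landsberg structure on a 3-manifold $\Sigma$ is a coframing $\omega=(\omega^1,\omega^2,\omega^3)$ (three 1-forms on $\Sigma$, linearly independent at each point) satisfying the three displayed structure equations for some functions $I,K$ on $\Sigma$, called its invariants. Differentiating the structure equations gives the Bianchi identities $dI=I_1\omega^1+I_3\omega^3$ and $dK=K_1\omega^1+K_2\omega^2-KI\,\omega^3$, where for a function $f$ the directional derivatives $f_i$ are defined by $df=f_1\omega^1+f_2\omega^2+f_3\omega^3$. A generalized Landsberg structure is a generalized Berwald structure if $dI\equiv 0 \bmod \omega^3$, i.e. $I_1=I_2=0$ identically on $\Sigma$. It is called non-trivial if it is not of Berwald type. (The Riemannian case $I\equiv 0$ satisfies $dI\equiv 0 \bmod \omega^3$, so it is not non-trivial.) *)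

(* Defs.v *)
From HB Require Import structures.
From mathcomp Require Import all_boot all_order all_algebra.
From mathcomp Require Import all_classical all_reals all_analysis.

Set Implicit Arguments.
Unset Strict Implicit.
Unset Printing Implicit Defensive.

Import Order.TTheory GRing.Theory Num.Theory.
Import numFieldNormedType.Exports.

Local Open Scope classical_set_scope.
Local Open Scope ring_scope.

Definition partial (R : realType) (n : nat) (j : 'I_n) (f : 'rV[R]_n -> R) :
  'rV[R]_n -> R := 'D_(delta_mx 0 j) f.

Definition gradient (R : realType) (n : nat) (f : 'rV[R]_n -> R)
  (x : 'rV[R]_n) : 'rV[R]_n := \row_j partial j f x.

(* [U] is meant to be open.  All iterated partial derivatives being (Fréchet)
   differentiable, hence continuous, on [U] is the same as being C^oo there. *)
Definition smooth_on (R : realType) (n : nat) (U : set 'rV[R]_n)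
    (f : 'rV[R]_n -> R) : Prop :=
  forall (s : seq 'I_n) (x : 'rV[R]_n), U x ->
    differentiable (foldr (@partial R n) f s) x.

(* The sum of [F alpha] over the multi-indices with all entries below [N].  For
   absolutely convergent multiple series, the limit over [N] is the sum. *)
Definition cube_sum (R : realType) (n : nat) (F : {ffun 'I_n -> nat} -> R)
    (N : nat) : R :=
  \sum_(alpha : {ffun 'I_n -> 'I_N}) F [ffun i => nat_of_ord (alpha i)].

Definition monomial (R : realType) (n : nat) (alpha : {ffun 'I_n -> nat})
  (h : 'rV[R]_n) : R := \prod_i h 0 i ^+ alpha i.

(* The norm of ['rV[R]_n] is the sup norm, so [`|h| < r] is a polydisc. *)
Definition analytic_at (R : realType) (n : nat) (f : 'rV[R]_n -> R)
    (x : 'rV[R]_n) : Prop :=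
  exists (c : {ffun 'I_n -> nat} -> R) (r : R), 0 < r /\
    forall h : 'rV[R]_n, `|h| < r ->
      cvgn (cube_sum (fun alpha => `|c alpha * monomial alpha h|)) /\
      cube_sum (fun alpha => c alpha * monomial alpha h) @ \oo --> f (x + h).

Definition analytic_on (R : realType) (n : nat) (U : set 'rV[R]_n)
    (f : 'rV[R]_n -> R) : Prop :=
  forall x, U x -> analytic_at f x.

(* A manifold of dimension [n] with a real-analytic atlas.  The chart [a] is the
   homeomorphism [chart a] from [chart_dom a] onto [chart_img a], with inverse
   [chart_inv a]; both maps are total, with arbitrary values elsewhere. *)
Record manifold (R : realType) (n : nat) := Manifold {
  point :> topologicalType ;
  point_hausdorff : hausdorff_space point ;
  point_second_countable : @second_countable point ;
  atlas : Type ;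
  chart_dom : atlas -> set point ;
  chart_img : atlas -> set 'rV[R]_n ;
  chart : atlas -> point -> 'rV[R]_n ;
  chart_inv : atlas -> 'rV[R]_n -> point ;
  chart_dom_open : forall a, open (chart_dom a) ;
  chart_img_open : forall a, open (chart_img a) ;
  chart_cover : forall p, exists a, chart_dom a p ;
  chart_maps : forall a p, chart_dom a p -> chart_img a (chart a p) ;
  chart_inv_maps : forall a x, chart_img a x -> chart_dom a (chart_inv a x) ;
  chartK : forall a p, chart_dom a p -> chart_inv a (chart a p) = p ;
  chart_invK : forall a x, chart_img a x -> chart a (chart_inv a x) = x ;
  chart_continuous : forall a p, chart_dom a p -> {for p, continuous (chart a)} ;
  chart_inv_continuous :
    forall a x, chart_img a x -> {for x, continuous (chart_inv a)} ;
  transition_analytic : forall a b (k : 'I_n),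
    analytic_on [set x | chart_img a x /\ chart_dom b (chart_inv a x)]
      (fun x => chart b (chart_inv a x) 0 k)
}.

Arguments chart_dom {R n} m a.
Arguments chart_img {R n} m a.
Arguments chart {R n} m a p.
Arguments chart_inv {R n} m a x.

(* The part of chart [a] that chart [b] covers, in the coordinates of [a]. *)
Definition overlap (R : realType) (n : nat) (M : manifold R n) (a b : atlas M) :
    set 'rV[R]_n :=
  [set x | chart_img M a x /\ chart_dom M b (chart_inv M a x)].

Definition transition (R : realType) (n : nat) (M : manifold R n)
  (a b : atlas M) (x : 'rV[R]_n) : 'rV[R]_n := chart M b (chart_inv M a x).

Definition smooth_function (R : realType) (n : nat) (M : manifold R n)
    (f : M -> R) : Prop :=
  forall a : atlas M, smooth_on (chart_img M a) (fun x => f (chart_inv M a x)).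

Definition analytic_function (R : realType) (n : nat) (M : manifold R n)
    (f : M -> R) : Prop :=
  forall a : atlas M,
    analytic_on (chart_img M a) (fun x => f (chart_inv M a x)).

(* Smooth 1-forms: [theta a x 0 j] is the coefficient of dx^j in the chart [a],
   at the point with coordinates [x].  [v *m 'J t x] is the differential of [t]
   applied to the row vector [v], so covectors, written as rows, pull back by
   the transpose of ['J t x]. *)
Record one_form (R : realType) (n : nat) (M : manifold R n) := OneForm {
  local_form :> atlas M -> 'rV[R]_n -> 'rV[R]_n ;
  local_form_smooth : forall a (j : 'I_n),
    smooth_on (chart_img M a) (fun x => local_form a x 0 j) ;
  local_form_compat : forall a b x, overlap a b x ->
    local_form a x =
      local_form b (transition a b x) *m ('J (transition a b) x)^T
}.

(* 2-forms at a point of a chart are written as skew-symmetric matrices, the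
   entry (j, k) being the value on the j-th and k-th coordinate vectors. *)
Definition wedge (R : realType) (n : nat) (u v : 'rV[R]_n) : 'M[R]_n :=
  \matrix_(j, k) (u 0 j * v 0 k - u 0 k * v 0 j).

Definition ext_d (R : realType) (n : nat) (theta : 'rV[R]_n -> 'rV[R]_n)
    (x : 'rV[R]_n) : 'M[R]_n :=
  \matrix_(j, k) (partial j (fun y => theta y 0 k) x
                  - partial k (fun y => theta y 0 j) x).

Record coframing (R : realType) (n : nat) (M : manifold R n) := Coframing {
  coframe :> 'I_n -> one_form M ;
  coframe_free : forall a x, chart_img M a x ->
    row_free (\matrix_i coframe i a x)
}.

(* The forms omega^1, omega^2, omega^3 are [w 0], [w 1], [w 2]. *)
Definition landsberg_equations (R : realType) (M : manifold R 3)
    (w : coframing M) (I K : M -> R) : Prop :=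
  forall (a : atlas M) (x : 'rV[R]_3), chart_img M a x ->
    let p := chart_inv M a x in
    [/\ ext_d (w 0 a) x = - (I p *: wedge (w 0 a x) (w 2 a x))
                          + wedge (w 1 a x) (w 2 a x),
        ext_d (w 1 a) x = - wedge (w 0 a x) (w 2 a x)
      & ext_d (w 2 a) x = K p *: wedge (w 0 a x) (w 1 a x)].

(* [g i] is the directional derivative of [f] along the [i]-th vector of the
   dual frame: df is the sum of the [g i *: w i]. *)
Definition directional_derivatives (R : realType) (n : nat) (M : manifold R n)
    (w : coframing M) (f : M -> R) (g : 'I_n -> M -> R) : Prop :=
  forall (a : atlas M) (x : 'rV[R]_n), chart_img M a x ->
    gradient (fun y => f (chart_inv M a y)) x =
      \sum_i g i (chart_inv M a x) *: w i a x.

(* The structure equations determine [I] and [K], so the existential quantifier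
   only names the invariants of [w]. *)
Definition generalized_berwald (R : realType) (M : manifold R 3)
    (w : coframing M) : Prop :=
  exists I K : M -> R,
    [/\ smooth_function I, smooth_function K, landsberg_equations w I K
      & exists g : 'I_3 -> M -> R, directional_derivatives w I g /\
          forall p, g 0 p = 0 /\ g 1 p = 0].

(* Main.v *)
Require Import Defs.
From mathcomp Require Import all_boot all_order all_algebra.
From mathcomp Require Import all_classical all_reals all_analysis.
From mathcomp Require Import ring.

Set Implicit Arguments.
Unset Strict Implicit.
Unset Printing Implicit Defensive.

Import Order.TTheory GRing.Theory Num.Theory.
Import numFieldNormedType.Exports.

Local Open Scope classical_set_scope.
Local Open Scope ring_scope.

(* If K = 0, then omega^3 = dt and the structure equations have the solutions
   omega^1 = dx + (y + f(x)) dt, omega^2 = dy - x dt on R^3, with I = - f'(x)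
   and I_1 = - f''(x).  Taking f(x) = - x^2 gives I = 2 x and I_1 = 2. *)

(** * Second countability of matrix spaces *)

Lemma second_countable_matrix (R : realType) (m n : nat) :
  @second_countable 'M[R]_(m, n).
Proof.
(* Rational centres and radii 1/(k+1) keep the basis countable. *)
pose U (p : 'M[rat]_(m, n) * nat) : set 'M[R]_(m, n) :=
  ball (map_mx ratr p.1 : 'M[R]_(m, n)) p.2.+1%:R^-1.
exists (range U); first exact/(sub_countable (card_image_le _ _))/countableP.
split=> [_ [p _ <-]|M V /nbhs_ballP[e /= e0 eV]]; first exact: ball_open.
(* The radius is taken below e/2 because a point of the basic ball is reached from [M] in two steps,
   through the rational centre [Q]. *)
have [|N] := @ltr_add_invr R 0 (e / 2); first by rewrite divr_gt0.
rewrite add0r => Ne.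
have ratP i j : {q : rat | ball (M i j) N.+1%:R^-1 (ratr q)}.
  apply: cid.
  have [|r [Br [q _ qr]]] :=
      @dense_rat R _ _ (ball_open (M i j : R^o) N.+1%:R^-1).
    by exists (M i j); exact: ballxx.
  by exists q; rewrite qr.
pose Q := \matrix_(i, j) sval (ratP i j).
have QM : ball M N.+1%:R^-1 (map_mx ratr Q : 'M[R]_(m, n)).
  by split=> // i j; rewrite !mxE; exact: svalP (ratP i j).
exists (U (Q, N)); first by split; [exists (Q, N)|exact/ball_sym].
apply: subset_trans eV => P QP.
exact: ball_split (le_ball (ltW Ne) QM) (le_ball (ltW Ne) QP).
Qed.

(** * Power series of affine functions *)

Lemma cube_sum_affine (R : realType) (n : nat) (k : 'I_n)
    (F : {ffun 'I_n -> nat} -> R) (N : nat) :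
    (forall alpha, alpha != [ffun=> 0%N] ->
       alpha != [ffun i => (i == k) : nat] -> F alpha = 0) ->
  cube_sum F N.+2 = F [ffun=> 0%N] + F [ffun i => (i == k) : nat].
Proof.
move=> F0; rewrite /cube_sum.
(* The bound [N.+2] leaves room for both exponents 0 and 1, so [inord] is faithful on them. The two
   surviving multi-indices differ at [k], hence can be split off the sum one after the other. *)
have neq :
    [ffun i => inord (i == k)] != [ffun=> ord0] :> {ffun 'I_n -> 'I_N.+2}.
  apply/eqP => /ffunP/(_ k); rewrite !ffunE eqxx => /(congr1 val) /=.
  by rewrite inordK.
rewrite (bigD1 [ffun=> ord0])//= (bigD1 [ffun i => inord (i == k)])//=.
rewrite big1 ?addr0 => [|alpha /andP[alpha0 alphak]]; last first.
  apply: F0.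
    apply: contra_neq alpha0 => /ffunP E; apply/ffunP => i; apply/val_inj.
    by have := E i; rewrite !ffunE.
  apply: contra_neq alphak => /ffunP E; apply/ffunP => i; apply/val_inj.
  by have := E i; rewrite !ffunE /= inordK//; case: (_ == _).
congr (F _ + F _); apply/ffunP => i; rewrite !ffunE//= inordK//.
by case: (_ == _).
Qed.

(** Re-centred at [x], the function has constant term [a + b * x 0 k] and a single linear
    coefficient [b]. The cube sums are therefore stationary, and both limits are limits of
    eventually constant sequences. *)
Lemma analytic_at_affine (R : realType) (n : nat) (k : 'I_n) (a b : R)
    (x : 'rV[R]_n) : analytic_at (fun y => a + b * y 0 k) x.
Proof.
pose c (alpha : {ffun 'I_n -> nat}) : R :=
  if alpha == [ffun=> 0%N] then a + b * x 0 k
  else if alpha == [ffun i => (i == k) : nat] then b else 0.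
have /negbTE neq :
    [ffun i => (i == k) : nat] != [ffun=> 0%N] :> {ffun 'I_n -> nat}.
  by apply/eqP => /ffunP/(_ k); rewrite !ffunE eqxx.
exists c, 1; split=> // h _; split.
  apply: (@cvgP _ _ (`|c [ffun=> 0%N] * monomial [ffun=> 0%N] h| +
    `|c [ffun i => (i == k) : nat] * monomial [ffun i => (i == k) : nat] h|)).
  (* Shifting by 2 skips the cubes too small to contain the linear term. *)
  rewrite -(cvg_shiftn 2); apply: cvg_near_cst; near=> N.
  rewrite /= addn2 (@cube_sum_affine _ _ k)// => alpha /negbTE a0 /negbTE ak.
  by rewrite /c a0 ak mul0r normr0.
rewrite -(cvg_shiftn 2); apply: cvg_near_cst; near=> N.
rewrite /= addn2 (@cube_sum_affine _ _ k);
    last first => [alpha /negbTE a0 /negbTE ak|].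
  by rewrite /c a0 ak mul0r.
rewrite /c neq !eqxx /monomial big1 => [|i _]; last by rewrite ffunE.
rewrite (bigD1 k)//= big1 => [|i /negbTE ik]; last by rewrite ffunE ik.
by rewrite ffunE eqxx expr1 !mulr1 mxE mulrDr addrA.
Unshelve. all: by end_near. Qed.

(** * Polynomial functions and their smoothness *)

Inductive polynomial_fun (R : realType) (n : nat) : ('rV[R]_n -> R) -> Prop :=
| polynomial_cst a : polynomial_fun (cst a)
| polynomial_coord k : polynomial_fun (fun x => x 0 k)
| polynomialD f g :
    polynomial_fun f -> polynomial_fun g -> polynomial_fun (f + g)
| polynomialM f g :
    polynomial_fun f -> polynomial_fun g -> polynomial_fun (f * g).

Section Partial.
Variables (R : realType) (n : nat).
Implicit Types (f g : 'rV[R]_n -> R) (x : 'rV[R]_n) (j k : 'I_n).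

Lemma partial_cst j (a : R) : partial j (cst a) = cst 0.
Proof. by apply/funext => x; exact: derive_cst. Qed.

Lemma partial_coord j k : partial j (fun x => x 0 k) = cst (k == j)%:R.
Proof.
apply/funext => x; rewrite /partial /derive/=; apply: cvg_lim => //.
(* The difference quotient does not depend on [h] once [h] is nonzero. *)
apply: cvg_near_cst; near=> h.
rewrite !mxE eqxx/= addrK scalerA mulVf ?scale1r//.
by near: h; exact: nbhs_dnbhs_neq.
Unshelve. all: by end_near. Qed.

Lemma partialD j f g x : differentiable f x -> differentiable g x ->
  partial j (f + g) x = partial j f x + partial j g x.
Proof. by move=> df dg; rewrite /partial deriveD//; exact: diff_derivable. Qed.

Lemma partialM j f g x : differentiable f x -> differentiable g x ->
  partial j (f * g) x = f x * partial j g x + g x * partial j f x.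
Proof. by move=> df dg; rewrite /partial deriveM//; exact: diff_derivable. Qed.

Lemma polynomial_differentiable f x : polynomial_fun f -> differentiable f x.
Proof.
elim=> {f} [a|k|f g _ df _ dg|f g _ df _ dg].
- exact: differentiable_cst.
- exact: differentiable_coord.
- exact: differentiableD.
- exact: differentiableM.
Qed.

Lemma polynomial_partial j f : polynomial_fun f -> polynomial_fun (partial j f).
Proof.
elim=> {f} [a|k|f g pf pf' pg pg'|f g pf pf' pg pg'].
- by rewrite partial_cst; exact: polynomial_cst.
- by rewrite partial_coord; exact: polynomial_cst.
- have -> : partial j (f + g) = partial j f + partial j g.
    by apply/funext => x; rewrite partialD//; exact: polynomial_differentiable.
  exact: polynomialD.
- have -> : partial j (f * g) = f * partial j g + g * partial j f.
    by apply/funext => x; rewrite partialM//; exact: polynomial_differentiable.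
  by apply: polynomialD; exact: polynomialM.
Qed.

(** Smoothness asks for differentiability of every iterated partial derivative. Polynomials are
    differentiable and closed under [partial], so induction on the list of directions suffices. *)
Lemma polynomial_smooth_on (U : set 'rV[R]_n) f :
  polynomial_fun f -> smooth_on U f.
Proof.
move=> pf s x _; apply: polynomial_differentiable.
by elim: s => //= j s; exact: polynomial_partial.
Qed.

End Partial.

(** * Euclidean space with a single global chart *)

Section EuclideanSpace.
Variables (R : realType) (n : nat).

(** Supplies the analyticity of the transition map, which is the identity when there is only one
    chart. *)
Lemma coord_analytic_on (U : set 'rV[R]_n) (k : 'I_n) :
  analytic_on U (fun x => x 0 k).
Proof.
move=> x _; have := analytic_at_affine k 0 1 x.
by under [X in analytic_at X]eq_fun do rewrite add0r mul1r.
Qed.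

Lemma continuous_id_on (x : 'rV[R]_n) : {for x, continuous id}.
Proof. exact: cvg_id. Qed.

Definition euclidean_space : manifold R n :=
  @Manifold R n 'rV[R]_n (@norm_hausdorff _ _)
    (@second_countable_matrix R 1 n) unit (fun=> setT) (fun=> setT)
    (fun=> id) (fun=> id) (fun=> openT) (fun=> openT)
    (fun p => ex_intro _ tt Logic.I) (fun _ _ _ => Logic.I)
    (fun _ _ _ => Logic.I) (fun _ _ _ => erefl) (fun _ _ _ => erefl)
    (fun _ p _ => @continuous_id_on p) (fun _ p _ => @continuous_id_on p)
    (fun _ _ k => @coord_analytic_on _ k).

Lemma jacobian_id (x : 'rV[R]_n) : 'J id x = 1%:M.
Proof.
by apply/row_matrixP => i; rewrite !rowE -deriveEjacobian// derive_id mulmx1.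
Qed.

Lemma global_form_compat (theta : 'rV[R]_n -> 'rV[R]_n)
    (a b : atlas euclidean_space) x : overlap a b x ->
  theta x = theta (transition a b x) *m ('J (transition a b) x)^T.
(* [transition a b] is convertible to [id], so the pullback is multiplication by the identity
   matrix. *)
Proof. by move=> _; rewrite (jacobian_id x) trmx1 mulmx1. Qed.

Definition global_form (theta : 'rV[R]_n -> 'rV[R]_n)
    (theta_smooth : forall j, smooth_on setT (fun x => theta x 0 j)) :
    one_form euclidean_space :=
  @OneForm R n euclidean_space (fun=> theta) (fun=> theta_smooth)
    (@global_form_compat theta).

End EuclideanSpace.

(** * The explicit coframing and its invariants *)

Section Example.
Variable R : realType.
Implicit Types (x : 'rV[R]_3) (i j k : 'I_3).

(* In the coordinates (x, y, t) of R^3, the rows are dx + (y - x^2) dt,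
   dy - x dt and dt. *)
Definition frame_coef i j : 'rV[R]_3 -> R :=
  match val i, val j with
  | 0%N, 0%N | 1%N, 1%N | 2%N, 2%N => cst 1
  | 0%N, 2%N =>
      (fun x => x 0 1) + cst (-1) * ((fun x => x 0 0) * (fun x => x 0 0))
  | 1%N, 2%N => cst (-1) * (fun x => x 0 0)
  | _, _ => cst 0
  end.

Lemma frame_coef_polynomial i j : polynomial_fun (frame_coef i j).
Proof.
rewrite /frame_coef; case: (val i) => [|[|[|?]]]; case: (val j) => [|[|[|?]]];
  do ?[exact: polynomial_cst|exact: polynomial_coord|exact: polynomialD
      |apply: polynomialD|apply: polynomialM].
Qed.

Definition frame_row i x : 'rV[R]_3 := \row_j frame_coef i j x.

Lemma frame_row_smooth i j : smooth_on setT (fun x => frame_row i x 0 j).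
Proof.
have -> : (fun x => frame_row i x 0 j) = frame_coef i j.
  by apply/funext => x; rewrite mxE.
exact/polynomial_smooth_on/frame_coef_polynomial.
Qed.

Definition frame_form i : one_form (euclidean_space R 3) :=
  global_form (frame_row_smooth i).

(** The coefficient matrix is upper triangular with unit diagonal. It is transposed because
    [det_trig] concerns lower triangular matrices. *)
Lemma frame_form_free (a : atlas (euclidean_space R 3)) x :
  chart_img (euclidean_space R 3) a x -> row_free (\matrix_i frame_form i a x).
Proof.
move=> _; rewrite row_free_unit unitmxE -det_tr det_trig.
  rewrite big1 ?unitr1// => -[[|[|[|//]]] ?] _; by rewrite !mxE.
by apply/is_trig_mxP => -[[|[|[|//]]] ?] [[|[|[|//]]] ?] // _; rewrite !mxE.
Qed.

Definition frame : coframing (euclidean_space R 3) := Coframing frame_form_free.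

(** Only the dt-coefficients of the first two forms, y - x^2 and - x, are non-constant. *)
Lemma partial_frame_row k i j x : partial k (fun y => frame_row i y 0 j) x =
  match val i, val j with
  | 0%N, 2%N => (k == 1)%:R - 2 * x 0 0 * (k == 0)%:R
  | 1%N, 2%N => - (k == 0)%:R
  | _, _ => 0
  end.
Proof.
have -> : (fun y => frame_row i y 0 j) = frame_coef i j.
  by apply/funext => y; rewrite mxE.
have d0 : differentiable (fun y : 'rV[R]_3 => y 0 0) x.
  exact: differentiable_coord.
have dc (c : R) : differentiable (cst c : 'rV[R]_3 -> R) x.
  exact: differentiable_cst.
rewrite /frame_coef; case: (val i) => [|[|[|?]]]; case: (val j) => [|[|[|?]]];
  rewrite ?partial_cst//.
- rewrite partialD; first last.
  + by apply: differentiableM => //; exact: differentiableM.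
  + exact: differentiable_coord.
  rewrite partialM//; last exact: differentiableM.
  rewrite partialM// !partial_coord partial_cst /= -!(eq_sym k) !fctE.
  ring.
- by rewrite partialM// partial_coord partial_cst /= mulr0 addr0 mulN1r eq_sym.
Qed.

(** Here omega^1 ^ omega^3 = dx ^ dt and omega^2 ^ omega^3 = dy ^ dt, while d omega^1 = dy ^ dt - 2
    x dx ^ dt, d omega^2 = - dx ^ dt and d omega^3 = 0. *)
Lemma frame_landsberg :
  landsberg_equations frame (fun p : 'rV[R]_3 => 2 * p 0 0) (cst 0).
Proof.
move=> a x _ /=; split; apply/matrixP => -[[|[|[|//]]] ?] [[|[|[|//]]] ?];
  rewrite !mxE !partial_frame_row /= /frame_coef /=; ring.
Qed.

(** The Berwald condition quantifies over the invariants, so [I] must be pinned down. In the dx ^ dt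
    component of the first equation, omega^2 ^ omega^3 contributes 0 and omega^1 ^ omega^3
    contributes 1, which isolates [I]. *)
Lemma frame_invariant (I K : euclidean_space R 3 -> R) x :
  landsberg_equations frame I K -> I x = 2 * x 0 0.
Proof.
move=> /(_ tt x Logic.I)[/matrixP/(_ 0 2%:R) + _ _].
rewrite !mxE !partial_frame_row /= /frame_coef /=.
by rewrite !mulr0 !subr0 !mulr1 sub0r addr0 => /oppr_inj.
Qed.

End Example.

Theorem corollary4p3 (R : realType) :
  exists (Sigma : manifold R 3) (w : coframing Sigma) (I K : Sigma -> R),
    analytic_function I /\ analytic_function K /\
    landsberg_equations w I K /\
    ~ generalized_berwald w.
Proof.
exists (euclidean_space R 3), (frame R),
  (fun p : 'rV[R]_3 => 2 * p 0 0), (cst 0).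
split=> [a x _|].
  have := analytic_at_affine 0 0 2 x.
  by under [X in analytic_at X]eq_fun do rewrite add0r.
split=> [a x _|].
  have := analytic_at_affine 0 0 0 x.
  by under [X in analytic_at X]eq_fun do rewrite add0r mul0r.
split; first exact: frame_landsberg.
move=> [I [K [_ _ eqI [g [dI g0]]]]].
have [g00 g10] := g0 (chart_inv (euclidean_space R 3) tt 0).
(* The dx-component of dI at the origin gives the contradiction 2 = 0: the left side is the
   x-derivative of 2 x, and the right side vanishes term by term. *)
have /rowP/(_ 0) := dI tt 0 Logic.I.
have -> : (fun y => I (chart_inv (euclidean_space R 3) tt y)) =
    cst 2 * (fun y : 'rV[R]_3 => y 0 0).
  by apply/funext => y; exact: frame_invariant eqI.
rewrite !mxE summxE big1 => [|i _]; last first.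
  case: i => [[|[|[|//]]] lti]; rewrite !mxE.
  - have -> : Ordinal lti = 0 by exact/val_inj.
    by rewrite g00 mul0r.
  - have -> : Ordinal lti = 1 by exact/val_inj.
    by rewrite g10 mul0r.
  (* No assumption is made on [g 2]; its term vanishes because omega^3 = dt has no dx-component. *)
  - by rewrite mulr0.
rewrite partialM; [|exact: differentiable_cst|exact: differentiable_coord].
rewrite partial_coord partial_cst /= mulr0 addr0 mulr1 => /eqP.
by rewrite pnatr_eq0.
Qed.
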